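(* Let $\mathcal{G}$ be the family of finite, labeled, weighted trees with at least two vertices, and let $\Psi$ be the augmented labeling scheme given by $\psi_G(u)=(\phi_G(u),\phi'_G(u))$, where $\phi_G$ is the primary label and $\phi'_G(u)=\{\!\{\alpha(u,u'):u'\in N_G(u)\}\!\}$ is the multiweight label. Then OGJ with cost $c_\Psi$ detects and identifies isomorphism for $\mathcal{G}$.
   Context: A weight function on a finite set $U$ is $\alpha:U\times U\to\mathbb{R}$ with $\alpha\ge0$, symmetric, $\sum\alpha=1$; marginal $p(u)=\sum_{u'}\alpha(u,u')$. A graph is $G=(U,\alpha,\phi_G)$, with primary label function $\phi_G:U\to\mathcal{L}$; its edges are the pairs with $\alpha>0$, and $N_G(u)=\{u':\alpha(u,u')>0\}$. A weighted labeled tree is such a graph whose underlying undirected graph (edges $\{u,u'\}$ with $\alpha(u,u')>0$) is a tree (connected, no cycles, no self-loops). $\{\!\{\cdot\}\!\}$ denotes a multiset. $G\cong H$ means there is a bijection $f:U\to V$ with $\alpha(u,u')=\beta(f(u),f(u'))$ and $\phi_G(u)=\phi_H(f(u))$. Weight joinings of $\alpha$ (marginal $p$) and $\beta$ (marginal $q$): weight functions $\gamma$ on $U\times V$ with marginal $r_\gamma(u,v)=\sum_{u',v'}\gamma((u,v),(u',v'))$ satisfying $\sum_v r_\gamma(u,v)=p(u)$, $\sum_u r_\gamma(u,v)=q(v)$, $p(u)\sum_{\tilde v}\gamma((u,v),(u',\tilde v))=\alpha(u,u')r_\gamma(u,v)$, $q(v)\sum_{\tilde u}\gamma((u,v),(\tilde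 u,v'))=\beta(v,v')r_\gamma(u,v)$; set $\mathcal{J}(\alpha,\beta)$. Bijective: each $u$ has a unique $v$ with $r_\gamma(u,v)>0$ and each $v$ a unique such $u$. $c_\Psi(u,v)=\mathbb{I}(\psi_G(u)\ne\psi_H(v))$; $\rho_\Psi(G,H)=\min_{\gamma\in\mathcal{J}(\alpha,\beta)}\sum c_\Psi r_\gamma$, $\mathcal{J}^*_\Psi(\alpha,\beta)$ the minimizers. OGJ with cost $c_\Psi$ detects isomorphism for $\mathcal{G}$ if $\rho_\Psi(G,H)=0\iff G\cong H$ for all $G,H\in\mathcal{G}$; it identifies isomorphism if for every isomorphic pair $G=(U,\alpha,\phi_G)$, $H=(V,\beta,\phi_H)$ in $\mathcal{G}$ the extreme points of $\mathcal{J}^*_\Psi(\alpha,\beta)$ are exactly the bijective $\gamma\in\mathcal{J}(\alpha,\beta)$ with $\sum c_\Psi r_\gamma=0$. *)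

(* Defs.v *)
Set Warnings "-notation-overridden,-notation-incompatible-prefix".
From HB Require Import structures.
From mathcomp Require Import all_boot all_order all_algebra.
From mathcomp Require Import finmap multiset.
From mathcomp Require Import all_classical all_reals all_analysis.
From mathcomp Require Import ring.

Set Implicit Arguments.
Unset Strict Implicit.
Unset Printing Implicit Defensive.

Import Order.TTheory GRing.Theory Num.Theory.
Import numFieldNormedType.Exports.

Local Open Scope classical_set_scope.
Local Open Scope ring_scope.

Section WeightFunctions.
Context {R : realType}.

Definition is_weight (T : finType) (w : T * T -> R) : Prop :=
  [/\ forall x y, 0 <= w (x, y),
      forall x y, w (x, y) = w (y, x) &
      \sum_x \sum_y w (x, y) = 1].

Definition marginal (T : finType) (w : T * T -> R) (x : T) : R :=
  \sum_y w (x, y).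

Definition weight_joining (U V : finType) (alpha : U * U -> R)
    (beta : V * V -> R) : set ((U * V) * (U * V) -> R) :=
  [set gamma |
    let p := marginal alpha in
    let q := marginal beta in
    let r := marginal gamma in
    [/\ is_weight gamma,
        forall u, \sum_v r (u, v) = p u,
        forall v, \sum_u r (u, v) = q v,
        forall u u' v,
          p u * \sum_w gamma ((u, v), (u', w)) = alpha (u, u') * r (u, v) &
        forall u v v',
          q v * \sum_w gamma ((u, v), (w, v')) = beta (v, v') * r (u, v)]].

Definition bijective_joining (U V : finType)
    (gamma : (U * V) * (U * V) -> R) : Prop :=
  (forall u, exists! v, 0 < marginal gamma (u, v)) /\
  (forall v, exists! u, 0 < marginal gamma (u, v)).

Definition extreme_points (E : lmodType R) (A : set E) : set E :=
  [set x | A x /\ forall y z t, A y -> A z -> 0 < t < 1 ->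
                    x = t *: y + (1 - t) *: z -> y = x /\ z = x].

End WeightFunctions.

Record graph (R : realType) (L : Type) := Graph {
  vertex :> finType;
  weight : vertex * vertex -> R;
  label : vertex -> L;
  weightP : is_weight weight }.

Arguments weight {R L} _ _.

Section Graphs.
Context {R : realType}.

Section OneLabelType.
Context {L : Type}.
Implicit Types G H : graph R L.

Definition neighbors G (u : G) : {set G} := [set u' | 0 < weight G (u, u')]%SET.

Definition adj G : rel G := fun u u' => u' \in neighbors u.
Arguments adj : clear implicits.

Definition is_tree G : Prop :=
  [/\ forall u v : G, connect (adj G) u v,
      forall c : seq G, (2 < size c)%N -> ~ ucycle (adj G) c &
      irreflexive (adj G)].

Definition isomorphic G H : Prop :=
  exists f : G -> H,
    [/\ bijective f,
        forall u u', weight G (u, u') = weight H (f u, f u') &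
        forall u, label u = label (f u)].

End OneLabelType.

Section OGJ.
Context {L : Type} {K : eqType}.
Implicit Types G H : graph R L.

Definition labeling := forall G, G -> K.

Variable Psi : labeling.

Definition label_cost G H (x : G * H) : R := (Psi x.1 != Psi x.2)%:R.

Definition total_cost G H (gamma : (G * H) * (G * H) -> R) : R :=
  \sum_(x : G * H) label_cost x * marginal gamma x.

(* By total_cost_attained below, the infimum is a minimum. *)
Definition ogj_cost G H : R :=
  inf [set total_cost gamma |
         gamma in weight_joining (weight G) (weight H)].

Definition optimal_joining (G H : graph R L) : set ((G * H) * (G * H) -> R) :=
  [set gamma | weight_joining (weight G) (weight H) gamma /\
               total_cost gamma = ogj_cost G H].

Arguments optimal_joining : clear implicits.

Definition detects_isomorphism (F : graph R L -> Prop) : Prop :=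
  forall G H, F G -> F H -> (ogj_cost G H = 0 <-> isomorphic G H).

Definition identifies_isomorphism (F : graph R L -> Prop) : Prop :=
  forall G H, F G -> F H -> isomorphic G H ->
    extreme_points (optimal_joining G H) =
    [set gamma | [/\ weight_joining (weight G) (weight H) gamma,
                     bijective_joining gamma & total_cost gamma = 0]].

Section Attained.
Variables G H : graph R L.
Notation J := (weight_joining (weight G) (weight H)).
Let I : finType := ((G * H) * (G * H))%type.

Lemma weight_joining_product :
  J (fun x => weight G (x.1.1, x.2.1) * weight H (x.1.2, x.2.2)).
Proof.
have [a0 aC a1] := weightP G; have [b0 bC b1] := weightP H.
have mE (x : G * H) : marginal (fun x : I => weight G (x.1.1, x.2.1) *
    weight H (x.1.2, x.2.2)) x
    = marginal (weight G) x.1 * marginal (weight H) x.2.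
  rewrite /marginal big_distrlr/= pair_bigA/=; exact: eq_bigr.
split=> /=.
- split=> [x y|x y|]; first by rewrite mulr_ge0 ?a0 ?b0.
    by rewrite /= aC bC.
  transitivity (\sum_(x : G * H) marginal (weight G) x.1 * marginal (weight H) x.2).
    by apply: eq_bigr => x _; exact: mE.
  rewrite -(pair_bigA _ (fun u v => marginal (weight G) u * marginal (weight H) v))/=.
  by rewrite -big_distrlr /= a1 b1 mulr1.
- move=> u; under eq_bigr do rewrite mE/=.
  by rewrite -mulr_sumr b1 mulr1.
- move=> v; under eq_bigr do rewrite mE/=.
  by rewrite -mulr_suml a1 mul1r.
- by move=> u u' v; rewrite mE -mulr_sumr /= -/(marginal (weight H) v); ring.
- by move=> u v v'; rewrite mE -mulr_suml /= -/(marginal (weight G) u); ring.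
Qed.

Let X := prod_topology (fun _ : I => R : topologicalType).

Lemma cont_coord (i : I) : continuous (fun g : X => g i : R).
Proof. exact: (@proj_continuous I (fun=> R) i). Qed.

Lemma cont_sum (T : finType) (F : T -> X -> R) :
  (forall i, continuous (F i)) -> continuous (fun g => \sum_i F i g).
Proof.
move=> cF; elim: (index_enum T) => [|i s IHs].
  have -> : (fun g : X => \sum_(j <- [::]) F j g) = (fun=> 0).
    by apply/funext => g; rewrite big_nil.
  exact: cst_continuous.
have -> : (fun g : X => \sum_(j <- i :: s) F j g) =
          (fun g => F i g + \sum_(j <- s) F j g).
  by apply/funext => g; rewrite big_cons.
by move=> x; apply: (@continuousD R R X (F i) (fun g => \sum_(j <- s) F j g)); [exact: cF|exact: IHs].
Qed.

Lemma cont_scale (k : R) (F : X -> R) :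
  continuous F -> continuous (fun g => k * F g).
Proof. by move=> cF x; apply: (@continuousM R X (cst k) F); [exact: cst_continuous|exact: cF]. Qed.

Lemma closed_eqf (F F' : X -> R) : continuous F -> continuous F' ->
  closed [set g | F g = F' g].
Proof.
move=> cF cF'.
rewrite (_ : mkset _ = (fun g => F g - F' g) @^-1` [set 0]); last first.
  by apply/seteqP; split=> g /=; [move->; rewrite subrr|move/subr0_eq].
apply: closed_comp; last exact: closed_eq.
by move=> x _; apply: (@continuousB R R X F F'); [exact: cF|exact: cF'].
Qed.

Lemma closed_all (T : Type) (P : T -> X -> Prop) :
  (forall t, closed [set g | P t g]) -> closed [set g | forall t, P t g].
Proof.
move=> cP; rewrite (_ : mkset _ = \bigcap_t [set g | P t g]).
  exact: closed_bigI.
by apply/seteqP; split=> g /= h => [t _|t]; [exact: h|exact: h].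
Qed.

Lemma cont_marginal x : continuous (fun g : X => marginal (g : I -> R) x).
Proof. by apply: cont_sum => y; exact: cont_coord. Qed.

Lemma closed_joining : closed (J : set X).
Proof.
rewrite (_ : (J : set X) =
  [set g | forall i, 0 <= g i] `&` [set g | forall x y, g (x, y) = g (y, x)] `&`
  [set g | \sum_x \sum_y g (x, y) = 1] `&`
  [set g | forall u, \sum_v marginal (g : I -> R) (u, v) = marginal (weight G) u] `&`
  [set g | forall v, \sum_u marginal (g : I -> R) (u, v) = marginal (weight H) v] `&`
  [set g | forall u u' v, marginal (weight G) u * \sum_w g ((u, v), (u', w)) =
     weight G (u, u') * marginal (g : I -> R) (u, v)] `&`
  [set g | forall u v v', marginal (weight H) v * \sum_w g ((u, v), (w, v')) =
     weight H (v, v') * marginal (g : I -> R) (u, v)]); last first.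
  apply/seteqP; split=> g /=.
    by move=> [[? ? ?] ? ? ? ?]; do !split=> //; case.
  by move=> [[[[[[h ?] ?] ?] ?] ?] ?]; split=> //; split=> // x y; exact: h.
repeat apply: closedI.
- apply: closed_all => i.
  rewrite (_ : mkset _ = (fun g : X => g i : R) @^-1` [set x | 0 <= x])//.
  apply: closed_comp; last exact: closed_ge.
  by move=> x _; exact: cont_coord.
- do 2!apply: closed_all => ?; apply: closed_eqf; exact: cont_coord.
- apply: closed_eqf; last exact: cst_continuous.
  by do 2!apply: cont_sum => ?; exact: cont_coord.
- apply: closed_all => u; apply: closed_eqf; last exact: cst_continuous.
  by apply: cont_sum => ?; exact: cont_marginal.
- apply: closed_all => u; apply: closed_eqf; last exact: cst_continuous.
  by apply: cont_sum => ?; exact: cont_marginal.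
- do 3!apply: closed_all => ?; apply: closed_eqf; apply: cont_scale.
    by apply: cont_sum => ?; exact: cont_coord.
  exact: cont_marginal.
- do 3!apply: closed_all => ?; apply: closed_eqf; apply: cont_scale.
    by apply: cont_sum => ?; exact: cont_coord.
  exact: cont_marginal.
Qed.

Lemma compact_joining : compact (J : set X).
Proof.
apply: (@subclosed_compact X _ [set g : X | forall i, `[0, 1]%classic (g i)]).
- exact: closed_joining.
- have := @tychonoff I (fun=> R : topologicalType) (fun=> `[0, 1]%classic); apply=> i; exact: segment_compact.
move=> g [[g0 _ g1] _ _ _ _] [x y] /=; rewrite in_itv/= g0/= -g1.
rewrite (bigD1 x)//= (bigD1 y)//= -addrA lerDl addr_ge0//.
  by rewrite sumr_ge0// => *; exact: g0.
by rewrite sumr_ge0// => ? _; rewrite sumr_ge0// => *; exact: g0.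
Qed.

Lemma total_cost_attained :
  exists2 gamma, J gamma & total_cost gamma = ogj_cost G H
    /\ forall gamma', J gamma' -> total_cost gamma <= total_cost gamma'.
Proof.
have [||g] := @compact_EVT_min X R (fun g => total_cost (g : I -> R)) J _
    compact_joining.
- by exists (fun x => weight G (x.1.1, x.2.1) * weight H (x.1.2, x.2.2));
    exact: weight_joining_product.
- apply: continuous_subspaceT; apply: cont_sum => x.
  by apply: cont_scale; exact: cont_marginal.
rewrite inE => Jg gmin; exists g => //.
have {}gmin g' : J g' -> total_cost (g : I -> R) <= total_cost g'.
  by move=> Jg'; apply: gmin; rewrite inE.
split=> //; apply/eqP; rewrite eq_le; apply/andP; split.
  apply: lb_le_inf; first by exists (total_cost (g : I -> R)), g.
  by move=> _ [g' Jg' <-]; exact: gmin.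
apply: ge_inf; last by exists g.
by exists (total_cost (g : I -> R)) => _ [g' Jg' <-]; exact: gmin.
Qed.

End Attained.
End OGJ.

Definition multiweight (L : Type) (G : graph R L) (u : G) : ({mset R})%mset :=
  seq_mset [seq weight G (u, u') | u' in neighbors u].

Definition augmented_label (L : eqType) :
    labeling (L := L) (K := (L * {mset R}%mset)%type) :=
  fun G u => (label u, multiweight u).

Definition trees (L : Type) (G : graph R L) : Prop :=
  is_tree G /\ (1 < #|G|)%N.

End Graphs.

(* Main.v *)
Require Import Defs.
From mathcomp Require Import all_boot all_order all_algebra.
From mathcomp Require Import finmap multiset.
From mathcomp Require Import all_classical all_reals all_analysis.
From mathcomp Require Import zify ring lra.

(* A zero-cost joining gamma only couples vertices with the same label and the
   same multiset of incident weights.  It then only couples edges of equal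
   weight: an edge coupled to one of a different weight would be continued,
   because the two stars carry the same weights, by another such edge, and so
   on along an infinite nonbacktracking walk in a finite tree.  Hence at each
   coupled pair of vertices gamma is, weight class by weight class, a multiple
   of a doubly stochastic matrix, and by Hall's theorem any coupled pair of
   edges extends to a matching of the two stars inside the support of gamma.
   Gluing such matchings along the tree G gives a locally injective map to H,
   which is an isomorphism f as H is a tree.  The joining of the graph of f is
   supported in the support of gamma, so it can be split off from gamma; if
   gamma is extreme, it is that joining.  Conversely a joining is determined by
   its marginal being supported on a bijection, so bijective ones are extreme. *)

Set Implicit Arguments.
Unset Strict Implicit.
Unset Printing Implicit Defensive.

Import Order.TTheory GRing.Theory Num.Theory.

(** * Hall's theorem and nonbacktracking walks *)

Section Combinatorics.
Import boot.fintype boot.finset.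

Definition image_rel (T V : finType) (r : T -> V -> bool) (S : {set T}) : {set V} :=
  [set v | [exists u in S, r u v]]%SET.

(** Induction on the size of [D], after Halmos and Vaughan: either some nonempty proper subset is
    tight and can be matched separately from the rest, or every such subset has slack and one pair
    can be fixed freely. [v0] is the filler value for empty [D]. *)
Lemma hall_marriage (T V : finType) (r : T -> V -> bool) (D : {set T}) :
  T -> V ->
  (forall S : {set T}, S \subset D -> #|S| <= #|image_rel r S|) ->
  exists f : T -> V, {in D &, injective f} /\ {in D, forall u, r u (f u)}.
Proof.
move=> t0 v0; have [n] := ubnP #|D|; elim: n r D => // n IHn r D.
rewrite ltnS => leDn hallD.
have [->|/set0Pn[u uD]] := eqVneq D set0.
  by exists (fun=> v0); split=> [x y|x]; rewrite inE.
have [tight|slack] := boolP [exists S : {set T},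
    [&& S \proper D, S != set0 & #|image_rel r S| <= #|S|]].
- have /existsP[S /and3P[SD S0 tS]] := tight.
  have subSD := proper_sub SD.
  have [f [finj fr]] : exists f : T -> V,
      {in S &, injective f} /\ {in S, forall u, r u (f u)}.
    apply: IHn; first exact: leq_trans (proper_card SD) leDn.
    by move=> S' S'S; apply: hallD; exact: subset_trans S'S subSD.
  pose r' u v := r u v && (v \notin image_rel r S).
  have [g [ginj gr]] : exists g : T -> V,
      {in D :\: S &, injective g} /\ {in D :\: S, forall u, r' u (g u)}.
    apply: IHn.
      rewrite cardsDS//; have : 0 < #|S| by rewrite card_gt0.
      by have := proper_card SD; lia.
    move=> S'; rewrite subsetD -setI_eq0 => /andP[S'D /eqP dS'].
    (* Of the at least [#|S'| + #|S|] elements related to [S' :|: S], at most [#|S|] are related to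
       [S] by tightness, so [r'] keeps at least [#|S'|]. *)
    have := hallD (S' :|: S); rewrite subUset S'D subSD => /(_ isT).
    rewrite cardsU dS' cards0 subn0.
    have : #|image_rel r (S' :|: S)| <= #|image_rel r' S' :|: image_rel r S|.
      apply/subset_leq_card/fintype.subsetP => v; rewrite !inE.
      move=> /existsP[x]; rewrite inE => /andP[/orP[xS'|xS] rxv].
        have [//|vS] := boolP [exists u in S, r u v]; first by rewrite orbT.
        by rewrite orbF; apply/existsP; exists x; rewrite xS' /r' rxv inE.
      by apply/orP; right; apply/existsP; exists x; rewrite xS.
    rewrite cardsU; lia.
  have fS x : x \in S -> f x \in image_rel r S.
    by move=> xS; rewrite inE; apply/existsP; exists x; rewrite xS fr.
  have gS x : x \in D -> x \notin S -> g x \notin image_rel r S.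
    by move=> xD xS; have /andP[] := gr x (introT setDP (conj xD xS)).
  exists (fun x => if x \in S then f x else g x); split=> [x y xD yD|x xD].
    case: ifPn => xS; case: ifPn => yS.
    + exact: finj.
    + by move=> e; have := gS _ yD yS; rewrite -e fS.
    + by move=> e; have := gS _ xD xS; rewrite e fS.
    + by apply: ginj; rewrite inE ?xD ?yD ?xS ?yS.
  case: ifPn => xS; first exact: fr.
  by have /andP[] := gr x (introT setDP (conj xD xS)).
- have /card_gt0P[v] : 0 < #|image_rel r [set u]|.
    by apply: leq_trans (hallD _ _); rewrite ?cards1// sub1set.
  rewrite inE => /existsP[_ /andP[/set1P-> ruv]].
  pose r' x y := r x y && (y != v).
  have [g [ginj gr]] : exists g : T -> V,
      {in D :\ u &, injective g} /\ {in D :\ u, forall x, r' x (g x)}.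
    apply: IHn; first by rewrite (cardsD1 u D) uD in leDn.
    move=> S; rewrite subsetD1 => /andP[SD uS].
    have [->|S0] := eqVneq S set0; first by rewrite cards0.
    move: slack; rewrite negb_exists => /forallP/(_ S).
    have -> : S \proper D by apply/fintype.properP; split=> //; exists u.
    rewrite S0 /= -ltnNge => slackS.
    (* Removing [v] costs at most one element, which the strict inequality for [S] absorbs. *)
    have : #|image_rel r S| <= #|v |: image_rel r' S|.
      apply/subset_leq_card/fintype.subsetP => y; rewrite !inE.
      case: eqVneq => //= yv /existsP[x /andP[xS rxy]].
      by apply/existsP; exists x; rewrite xS /r' rxy.
    by rewrite cardsU1; lia.
  exists (fun x => if x == u then v else g x); split=> [x y xD yD|x xD].
    case: eqVneq => [->|xu]; case: eqVneq => [->|yu] //.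
    + move=> e; have /gr/andP[_] : y \in D :\ u by rewrite !inE yu.
      by rewrite e eqxx.
    + move=> e; have /gr/andP[_] : x \in D :\ u by rewrite !inE xu.
      by rewrite e eqxx.
    + by apply: ginj; rewrite !inE ?xu ?yu.
  case: eqVneq => [->//|xu].
  by have /gr/andP[] : x \in D :\ u by rewrite !inE xu.
Qed.

(** Strong induction on the gap between two visits of the same vertex: a shortest return would be a
    loop, a backtracking step or a cycle of length at least three. *)
Lemma nonbacktracking_inj (T : eqType) (e : rel T) (w : nat -> T) n :
  irreflexive e ->
  (forall c : seq T, 2 < size c -> ~ ucycle e c) ->
  (forall i, i < n -> e (w i) (w i.+1)) ->
  (forall i, i.+1 < n -> w i.+2 <> w i) ->
  {in [pred i | i <= n] &, injective w}.
Proof.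
move=> irr acyc we wnb.
have wpath d i : i + d <= n -> path e (w i) [seq w j | j <- iota i.+1 d].
  elim: d i => //= d IHd i; rewrite -addSnnS => lein.
  by rewrite we ?IHd//; lia.
have neq d : forall i, i + d.+1 <= n -> w i <> w (i + d.+1).
  have [m] := ubnP d; elim: m d => // m IHm [|[|d]] ledm i lein wi.
  - by have /we : i < n by [lia]; rewrite -addn1 -wi irr.
  - by have /wnb : i.+1 < n by [lia]; rewrite wi addn2.
  - have winj (j k : nat) : i <= j < i + d.+3 -> i <= k < i + d.+3 ->
        w j = w k -> j = k.
      move=> ji ki wjk; have [jk|jk|//] := ltngtP j k.
        have eqn : j + (k - j).-1.+1 = k by lia.
        by case: (IHm (k - j).-1 _ j); rewrite ?eqn//; lia.
      have eqn : k + (j - k).-1.+1 = j by lia.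
      by case: (IHm (j - k).-1 _ k); rewrite ?eqn//; lia.
    apply: (acyc [seq w j | j <- iota i d.+3]); first by rewrite size_map size_iota.
    apply/andP; split.
      have := wpath d.+3 i; rewrite lein => /(_ isT).
      rewrite -(addn1 d.+2) iotaD map_cat/= cats1 addSnnS -wi.
      by rewrite addn1.
    rewrite map_inj_in_uniq ?iota_uniq// => j k.
    by rewrite !mem_iota; exact: winj.
move=> i j; rewrite !inE => lein lejn wij.
have [ij|ij|//] := ltngtP i j.
  have eqn : i + (j - i).-1.+1 = j by lia.
  by case: (neq (j - i).-1 i); rewrite eqn.
have eqn : j + (i - j).-1.+1 = i by lia.
by case: (neq (i - j).-1 j); rewrite eqn.
Qed.

End Combinatorics.

Local Open Scope ring_scope.

(** Hall's condition is checked on [D] without [u0], with column [v0] removed. The rows in [S] carry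
    mass [k * #|S|]; less than [k] of it lies in column [v0], where row [u0] has a share, and every
    other column takes at most [k], so at least [#|S|] other columns are hit. *)
Lemma matching_through (R : realFieldType) (T V : finType) (m : T -> V -> R)
    (k : R) (D : {set T}) (u0 : T) (v0 : V) :
  (forall u v, 0 <= m u v) ->
  {in D, forall u, \sum_v m u v = k} ->
  (forall v, \sum_u m u v <= k) ->
  u0 \in D -> 0 < m u0 v0 ->
  exists f : T -> V,
    [/\ f u0 = v0, {in D &, injective f} & {in D, forall u, 0 < m u (f u)}].
Proof.
move=> m0 rows cols u0D m00.
have k0 : 0 < k.
  by rewrite -(rows u0)// (bigD1 v0)//= ltr_wpDr// sumr_ge0.
pose r u v := (0 < m u v) && (v != v0).
have [||S SD|f [finj fr]] := @hall_marriage T V r (D :\ u0)%SET; [exact: u0|exact: v0| |].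
  move: SD; rewrite subsetD1 => /andP[/fintype.subsetP SD u0S].
  (* The goal becomes [k * #|S| < k * #|image_rel r S| + k], where the last [k] pays for column
     [v0]. *)
  rewrite -ltnS -(ltr_nat R) -(ltr_pM2l k0) -[_.+1]addn1 natrD mulrDr mulr1.
  have -> : k * #|S|%:R = \sum_(u in S) \sum_v m u v.
    rewrite (eq_bigr (fun=> k)) ?sumr_const ?mulr_natr// => u uS.
    by rewrite rows// SD.
  rewrite exchange_big (bigD1 v0)//= addrC ler_ltD//; last first.
    apply: lt_le_trans (cols v0); rewrite [X in _ < X](bigID (mem S))/= ltrDl.
    by rewrite (bigD1 u0)//= ltr_wpDr// sumr_ge0.
  rewrite mulr_natr -sumr_const [X in _ <= X]big_mkcond/= big_mkcond/=.
  apply: ler_sum => v _; case: eqVneq => [->|vv0] /=.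
    by case: ifP => _ //; exact: ltW.
  case: ifPn => [_|]; first apply: le_trans (cols v).
    by rewrite [X in _ <= X](bigID (mem S))/= lerDl sumr_ge0.
  rewrite inE negb_exists => /forallP vS; rewrite big1// => u uS.
  have := vS u; rewrite uS /r vv0 andbT -leNgt => mle0.
  by apply/le_anti; rewrite mle0 m0.
exists (fun u => if u == u0 then v0 else f u); rewrite eqxx; split=> //.
- move=> x y xD yD; case: eqVneq => [->|x0]; case: eqVneq => [->|y0] //.
  + move=> e; have /fr/andP[_] : y \in (D :\ u0)%SET by rewrite !inE y0.
    by rewrite e eqxx.
  + move=> e; have /fr/andP[_] : x \in (D :\ u0)%SET by rewrite !inE x0.
    by rewrite e eqxx.
  + by apply: finj; rewrite !inE ?x0 ?y0.
- move=> u uD; case: eqVneq => [->//|u0'].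
  by have /fr/andP[] : u \in (D :\ u0)%SET by rewrite !inE u0'.
Qed.

(** * Basic properties of weight joinings *)

Section Joinings.
Context {R : realType}.

(** Exchanges the two factors, so that statements about [beta] follow from their counterparts about
    [alpha]. *)
Definition swap_joining (U V : finType) (gamma : (U * V) * (U * V) -> R) :
    (V * U) * (V * U) -> R :=
  fun z => gamma ((z.1.2, z.1.1), (z.2.2, z.2.1)).

Lemma marginal_swap (U V : finType) (gamma : (U * V) * (U * V) -> R) v u :
  marginal (swap_joining gamma) (v, u) = marginal gamma (u, v).
Proof.
rewrite /marginal [RHS](reindex (fun z : V * U => (z.2, z.1))).
  by apply: eq_bigr => -[].
by exists (fun z => (z.2, z.1)) => -[].
Qed.

Lemma swap_joiningP (U V : finType) (alpha : U * U -> R) (beta : V * V -> R)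
    (gamma : (U * V) * (U * V) -> R) :
  weight_joining alpha beta gamma ->
  weight_joining beta alpha (swap_joining gamma).
Proof.
move=> [[g0 gC g1] ra rb ta tb]; split.
- split=> [x y|x y|]; [exact: g0|exact: gC|].
  rewrite -[RHS]g1 [RHS](reindex (fun z : V * U => (z.2, z.1))); last first.
    by exists (fun z => (z.2, z.1)) => -[].
  by apply: eq_bigr => -[u v] _; exact: marginal_swap.
- by move=> v; rewrite -rb; apply: eq_bigr => u _; exact: marginal_swap.
- by move=> u; rewrite -ra; apply: eq_bigr => v _; exact: marginal_swap.
- by move=> v v' u; rewrite marginal_swap -tb.
- by move=> v u u'; rewrite marginal_swap -ta.
Qed.

Section JoiningFacts.
Variables (U V : finType) (alpha : U * U -> R) (beta : V * V -> R).
Variable gamma : (U * V) * (U * V) -> R.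
Hypothesis Jg : weight_joining alpha beta gamma.

Lemma joining_ge0 x y : 0 <= gamma (x, y).
Proof. by have [[]] := Jg. Qed.

Lemma joiningC x y : gamma (x, y) = gamma (y, x).
Proof. by have [[]] := Jg. Qed.

Lemma joining_marginal_ge0 x : 0 <= marginal gamma x.
Proof. by apply: sumr_ge0 => y _; exact: joining_ge0. Qed.

Lemma joining_marginal_gt0 x y : 0 < gamma (x, y) -> 0 < marginal gamma x.
Proof.
move=> gxy; rewrite /marginal (bigD1 y)//= ltr_wpDr// sumr_ge0// => z _.
exact: joining_ge0.
Qed.

Lemma marginal_gt0_l u v : 0 < marginal gamma (u, v) -> 0 < marginal alpha u.
Proof.
move=> r0; have [_ <- _ _ _] := Jg.
rewrite (bigD1 v)//= ltr_wpDr// sumr_ge0// => z _; exact: joining_marginal_ge0.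
Qed.

Lemma joining_transition_l u u' v : 0 < marginal alpha u ->
  \sum_w gamma ((u, v), (u', w)) =
  marginal gamma (u, v) / marginal alpha u * alpha (u, u').
Proof.
move=> p0; have [_ _ _ ta _] := Jg.
rewrite mulrAC mulrC [marginal gamma _ * _]mulrC -ta mulrA mulVf ?mul1r//.
exact: lt0r_neq0.
Qed.

Lemma joining_weight_gt0_l u v u' v' :
  0 < gamma ((u, v), (u', v')) -> 0 < alpha (u, u').
Proof.
move=> g0; have r0 := joining_marginal_gt0 g0.
have [_ _ _ ta _] := Jg; rewrite -(pmulr_lgt0 _ r0) -ta.
rewrite mulr_gt0 ?(marginal_gt0_l r0)// (bigD1 v')//= ltr_wpDr// sumr_ge0// => z _.
exact: joining_ge0.
Qed.

End JoiningFacts.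

Section JoiningFactsR.
Variables (U V : finType) (alpha : U * U -> R) (beta : V * V -> R).
Variable gamma : (U * V) * (U * V) -> R.
Hypothesis Jg : weight_joining alpha beta gamma.
Let Js := swap_joiningP Jg.

Lemma marginal_gt0_r u v : 0 < marginal gamma (u, v) -> 0 < marginal beta v.
Proof. by rewrite -marginal_swap; exact: (marginal_gt0_l Js). Qed.

Lemma joining_transition_r u v v' : 0 < marginal beta v ->
  \sum_w gamma ((u, v), (w, v')) =
  marginal gamma (u, v) / marginal beta v * beta (v, v').
Proof. by move=> q0; rewrite -marginal_swap -(joining_transition_l Js). Qed.

Lemma joining_weight_gt0_r u v u' v' :
  0 < gamma ((u, v), (u', v')) -> 0 < beta (v, v').
Proof. exact: (@joining_weight_gt0_l _ _ _ _ _ Js v u v' u'). Qed.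

Lemma joining_weight_eq0 u v u' v' :
  ~~ (0 < gamma ((u, v), (u', v'))) -> gamma ((u, v), (u', v')) = 0.
Proof. by rewrite lt0r (joining_ge0 Jg) andbT negbK => /eqP. Qed.

End JoiningFactsR.
End Joinings.

(** * Weighted trees and multiweights *)

Section Graphs.
Context {R : realType} {L : eqType}.
Implicit Types G H : graph R L.

Lemma weight_ge0 G (u u' : G) : 0 <= weight G (u, u').
Proof. by have [w0 _ _] := weightP G. Qed.

Lemma weightC G (u u' : G) : weight G (u, u') = weight G (u', u).
Proof. by have [_ wC _] := weightP G. Qed.

Lemma adjE G (u u' : G) : adj u u' = (0 < weight G (u, u')).
Proof. by rewrite /adj inE. Qed.

Lemma adjC G (u u' : G) : adj u u' = adj u' u.
Proof. by rewrite !adjE weightC. Qed.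

Lemma weight_nadj G (u u' : G) : ~~ adj u u' -> weight G (u, u') = 0.
Proof. by rewrite adjE lt0r weight_ge0 andbT negbK => /eqP. Qed.

(** Non-neighbours contribute [h 0 = 0], so the sum over all vertices is a sum over the multiset.
    The freedom in [h] and [W] gives marginals, degrees and the mass of a single weight class. *)
Lemma multiweight_sum (W : nmodType) (h : R -> W) G H (u : G) (v : H) :
  h 0 = 0 -> multiweight u = multiweight v ->
  \sum_u' h (weight G (u, u')) = \sum_v' h (weight H (v, v')).
Proof.
have E (K : graph R L) (x : K) : h 0 = 0 -> \sum_x' h (weight K (x, x')) =
    \sum_(a <- [seq weight K (x, x') | x' in neighbors x]) h a.
  move=> h0; rewrite big_image/= [RHS]big_mkcond/=; apply: eq_bigr => x' _.
  case: ifPn => // nx; rewrite weight_nadj//.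
by move=> h0 /eq_seq_msetP uv; rewrite !E//; exact: perm_big.
Qed.

Lemma multiweight_marginal G H (u : G) (v : H) :
  multiweight u = multiweight v ->
  marginal (weight G) u = marginal (weight H) v.
Proof. exact: (@multiweight_sum _ id). Qed.

Lemma multiweight_degree G H (u : G) (v : H) :
  multiweight u = multiweight v -> #|neighbors u| = #|neighbors v|.
Proof.
have E (K : graph R L) (x : K) : #|neighbors x| = (\sum_x' (0 < weight K (x, x'))%R)%N.
  by rewrite -sum1_card big_mkcond; apply: eq_bigr => x' _; rewrite inE; case: ifP.
by move=> uv; rewrite !E; apply: (@multiweight_sum _ (fun a => nat_of_bool (0 < a))) => //; rewrite ltxx.
Qed.

Lemma label_cost_ge0 (K : eqType) (Psi : labeling) G H (x : G * H) :
  0 <= label_cost (K := K) Psi x.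
Proof. by rewrite /label_cost ler0n. Qed.

Lemma tree_exists_neighbor G (u : G) : trees G -> exists u', adj u u'.
Proof.
move=> [[conn _ _]] /card_gt1P[x [y [_ _ xy]]].
have [z uz] : exists z, u != z.
  by have [ux|] := eqVneq u x; [exists y; rewrite ux|exists x].
have /connectP[[|u' p] /=] := conn u z; first by move=> _ uzE; rewrite uzE eqxx in uz.
by move=> /andP[uu' _] _; exists u'.
Qed.

(** * The support of a zero-cost joining *)

Section ZeroCost.
Variables (G H : graph R L) (gamma : (G * H) * (G * H) -> R).
Hypothesis Jg : weight_joining (weight G) (weight H) gamma.
Hypothesis c0 : total_cost (@augmented_label R L) gamma = 0.

Lemma zero_cost_label u v : 0 < marginal gamma (u, v) ->
  label u = label v /\ multiweight u = multiweight v.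
Proof.
move=> r0; move/eqP: c0; rewrite psumr_eq0; last first.
  by move=> x _; rewrite mulr_ge0 ?label_cost_ge0 ?(joining_marginal_ge0 Jg).
move=> /allP/(_ (u, v)); rewrite mem_index_enum => /(_ isT)/=.
rewrite mulf_eq0 (gt_eqF r0) orbF /label_cost pnatr_eq0 eqb0 negbK.
by rewrite xpair_eqE => /andP[/eqP ? /eqP].
Qed.

Lemma zero_cost_marginal u v : 0 < marginal gamma (u, v) ->
  marginal (weight G) u = marginal (weight H) v.
Proof. by move=> /zero_cost_label[_]; exact: multiweight_marginal. Qed.

(* Otherwise, for w the weight of (v', v), all the mass of the rows of weight w
   falls into the columns of weight w and fills them, as both have the same
   total mass; but the column v also gets mass from the row u. *)
Lemma unbalanced_step u v u' v' :
  0 < gamma ((u', v'), (u, v)) -> weight G (u', u) != weight H (v', v) ->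
  exists s t, [/\ s != u, 0 < gamma ((u', v'), (s, t)) &
    weight G (u', s) != weight H (v', t)].
Proof.
move=> g0 neq; have r0 := joining_marginal_gt0 Jg g0.
have [_ mw] := zero_cost_label r0.
have p0 := marginal_gt0_l Jg r0; have q0 := marginal_gt0_r Jg r0.
apply: contrapT => /forallNP noex.
set w := weight H (v', v) in neq noex.
(* [h] selects the weight class of [w]; its value [w] on that class turns [c * h] into a row or
   column mass and ensures [h 0 = 0]. [F] weighs rows of the class against columns of the class, and
   cancels in total because the two stars have the same multiweight. *)
pose h (a : R) : R := if a == w then w else 0.
pose F s t := gamma ((u', v'), (s, t)) *
  ((weight G (u', s) == w)%:R - (weight H (v', t) == w)%:R).
have Fsum : \sum_s \sum_t F s t = 0.
  pose c := marginal gamma (u', v') / marginal (weight G) u'.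
  transitivity (\sum_s c * h (weight G (u', s)) - \sum_t c * h (weight H (v', t))).
    under eq_bigr do (under eq_bigr do rewrite /F mulrBr; rewrite sumrB).
    rewrite sumrB; congr (_ - _).
      apply: eq_bigr => s _; rewrite -mulr_suml (joining_transition_l Jg)// /h.
      by case: eqP => [->|]; rewrite ?mulr1 ?mulr0.
    rewrite exchange_big/=.
    apply: eq_bigr => t _; rewrite -mulr_suml (joining_transition_r Jg)// /h.
    rewrite -(multiweight_marginal mw).
    by case: eqP => [->|]; rewrite ?mulr1 ?mulr0.
  rewrite -!mulr_sumr (multiweight_sum _ mw) ?subrr// /h.
  by case: eqVneq => // <-.
have Fle s t : F s t <= 0.
  rewrite /F; have [gst|/(joining_weight_eq0 Jg)->] :=
    boolP (0 < gamma ((u', v'), (s, t))); last by rewrite mul0r.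
  rewrite pmulr_rle0// subr_le0 ler_nat; case: eqVneq => // sw.
  case: eqVneq => // tw; case: (noex s) => //; exists t.
  split=> //; first by apply: contraNneq neq => <-; rewrite sw.
  by rewrite sw eq_sym.
have : \sum_s \sum_t F s t < 0.
  rewrite (bigD1 u)//= (bigD1 v)//= -addrA ltr_wnDr//; last first.
    by rewrite /F -/w eqxx (negbTE neq) sub0r mulrN1 oppr_lt0.
  by rewrite -oppr_ge0 opprD addr_ge0// oppr_ge0 sumr_le0// => s _; rewrite sumr_le0.
by rewrite Fsum ltxx.
Qed.

(* A violation propagates by [unbalanced_step] to an infinite nonbacktracking
   walk in the finite tree G. *)
Lemma support_weight u v u' v' : is_tree G ->
  0 < gamma ((u, v), (u', v')) -> weight G (u, u') = weight H (v, v').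
Proof.
move=> [_ acyc irr] g0; apply/eqP/negPn/negP => neq.
pose bad (s : (G * H) * (G * H)) :=
  (0 < gamma s) && (weight G (s.1.1, s.2.1) != weight H (s.1.2, s.2.2)).
(* A state is a coupled pair of edges; [next] extends a bad one at its far end without turning back
   in [G]. States that are not bad receive a dummy value. *)
have /boolp.choice[next nextP] : forall s, exists z : G * H,
    bad s -> bad (s.2, z) /\ z.1 != s.1.1.
  move=> [[a b] [a' b']]; have [/andP[/= gs neqs]|_] := boolP (bad (a, b, (a', b'))); last first.
    by exists (a, b).
  rewrite (joiningC Jg) in gs; rewrite weightC [X in _ != X]weightC in neqs.
  have [s [t [sa gst neqst]]] := unbalanced_step gs neqs.
  by exists (s, t) => _; split; first exact/andP.
pose S n := iter n (fun s => (s.2, next s)) ((u, v), (u', v')).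
have badS n : bad (S n).
  by elim: n => [|n /nextP[]//]; apply/andP; split.
pose w n := (S n).1.1.
have winj n : {in [pred i | i <= n]%N &, injective w}.
  apply: (nonbacktracking_inj irr acyc) => [i _|i _].
    rewrite adjE; have /andP[+ _] := badS i; rewrite /w /=.
    by case: (S i) => -[a b] [a' b'] /= /(joining_weight_gt0_l Jg).
  by apply/eqP; have /nextP[] := badS i.
have : (#|'I_#|G|.+1| <= #|G|)%N.
  apply: (@leq_card _ _ (fun i : 'I_#|G|.+1 => w i)) => i j wij; apply: val_inj.
  by apply: (winj #|G|) wij; rewrite inE -ltnS.
by rewrite card_ord ltnn.
Qed.

(** Dividing row [s] by the weight of its edge makes all rows sum to [k]. By [support_weight] the
    same division can be done by columns, so column sums are at most [k], and [matching_through]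
    treats all weight classes at once. *)
Lemma star_matching u v u0 v0 : is_tree G ->
  0 < gamma ((u, v), (u0, v0)) ->
  exists s : G -> H, [/\ s u0 = v0, {in neighbors u &, injective s} &
    forall u', adj u u' -> 0 < gamma ((u, v), (u', s u'))].
Proof.
move=> tG g0; have r0 := joining_marginal_gt0 Jg g0.
have p0 := marginal_gt0_l Jg r0; have q0 := marginal_gt0_r Jg r0.
have pq := zero_cost_marginal r0.
pose k := marginal gamma (u, v) / marginal (weight G) u.
have mgt0 s t : 0 < gamma ((u, v), (s, t)) / weight G (u, s) ->
    0 < gamma ((u, v), (s, t)).
  rewrite !lt0r (joining_ge0 Jg) andbT => /andP[+ _].
  by apply: contraNneq => ->; rewrite mul0r.
have := @matching_through R G H
  (fun s t => gamma ((u, v), (s, t)) / weight G (u, s)) k (neighbors u) u0 v0.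
case=> [s t|s|t|||f [f0 finj fpos]].
- by rewrite divr_ge0 ?(joining_ge0 Jg) ?weight_ge0.
- rewrite inE => us; rewrite -mulr_suml (joining_transition_l Jg)//.
  by rewrite mulfK// lt0r_neq0.
- have -> : \sum_s gamma ((u, v), (s, t)) / weight G (u, s) =
      \sum_s gamma ((u, v), (s, t)) / weight H (v, t).
    apply: eq_bigr => s _; have [gst|/(joining_weight_eq0 Jg)->] :=
      boolP (0 < gamma ((u, v), (s, t))); last by rewrite !mul0r.
    by rewrite (support_weight tG gst).
  rewrite -mulr_suml (joining_transition_r Jg)// -pq -/k.
  have [->|w0] := eqVneq (weight H (v, t)) 0; last by rewrite mulfK.
  by rewrite mulr0 mul0r divr_ge0 ?(joining_marginal_ge0 Jg)// ltW.
- by rewrite inE; exact: joining_weight_gt0_l Jg _ _ _ _ g0.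
- by rewrite divr_gt0// (joining_weight_gt0_l Jg g0).
exists f; split=> // u'; rewrite adjE => uu'.
by apply: mgt0; apply: fpos; rewrite inE.
Qed.

(* The map is built star by star: it is correct on the stars of a connected
   set I, and a vertex u outside I with a neighbour w in I is added by choosing
   a matching at u that maps w to f w; as there are no cycles, no other vertex
   of the star of u belongs to I or to a star centred in I. *)
Lemma exists_support_map : is_tree G ->
  exists f : G -> H,
    (forall u u', adj u u' -> 0 < gamma ((u, f u), (u', f u'))) /\
    (forall u, {in neighbors u &, injective f}).
Proof.
move=> tG; have [conn acyc irr] := tG.
have [[[r v0] [w0 z0]] g0] : exists z, 0 < gamma z.
  have [[_ _ g1] _ _ _ _] := Jg; apply: contrapT => /forallNP nog.
  move: g1; rewrite big1 => [/esym/eqP|x _]; first by rewrite oner_eq0.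
  by rewrite big1// => y _; apply/le_anti; rewrite (joining_ge0 Jg) andbT leNgt; exact/negP.
pose eI (I : {set G}) := [rel x y | [&& adj x y, x \in I & y \in I]].
pose good (I : {set G}) (f : G -> H) := [/\ r \in I,
  forall x, x \in I -> connect (eI I) r x,
  forall x, x \in I -> forall y, adj x y -> 0 < gamma ((x, f x), (y, f y)) &
  forall x, x \in I -> {in neighbors x &, injective f}].
suff grow n : (n < #|G|)%N -> exists (I : {set G}) f, #|I| = n.+1 /\ good I f.
  have G0 : (0 < #|G|)%N by apply/card_gt0P; exists r.
  have [|I [f [cI [_ _ fg finj]]]] := grow #|G|.-1; first by rewrite prednK.
  have IT x : x \in I.
    rewrite prednK// in cI; have : I == [set: G]%SET.
      by rewrite eqEcard finset.subsetT cardsT cI leqnn.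
    by move=> /eqP->; rewrite inE.
  by exists f; split=> [u u'|u]; [exact: fg|exact: finj].
elim: n => [_|n IHn ltn].
  have [s [_ sinj spos]] := star_matching tG g0.
  exists [set r]%SET, (fun x => if x == r then v0 else s x); split; first by rewrite cards1.
  split; first by rewrite inE.
  - by move=> x; rewrite inE => /eqP->; exact: connect0.
  - move=> x; rewrite inE => /eqP-> y ry; rewrite eqxx.
    by case: eqVneq ry => [->|_ ry]; [rewrite irr|exact: spos].
  - move=> x; rewrite inE => /eqP-> y z ry rz.
    case: eqVneq ry => [->|_ ry]; first by rewrite -[_ \in _]/(adj r r) irr.
    case: eqVneq rz => [->|_ rz]; first by rewrite -[_ \in _]/(adj r r) irr.
    exact: sinj.
have [I [f [cI [rI connI fpos finj]]]] := IHn (ltnW ltn).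
(* Otherwise [I] would be closed under adjacency, hence all of [G] by connectedness. *)
have [w [u [wI uI wu]]] : exists w u, [/\ w \in I, u \notin I & adj w u].
  apply: contrapT => nex.
  have clI : fingraph.closed (@adj R L G) (mem I).
    move=> x y xy; have [xI|xI] := boolP (x \in I); have [yI|yI] := boolP (y \in I) => //.
      by case: nex; exists x, y.
    by case: nex; exists y, x; rewrite adjC.
  suff : I = [set: G]%SET by move=> IT; move: ltn; rewrite -cI IT cardsT ltnn.
  apply/setP => x; rewrite inE.
  by have := closed_connect clI (conn r x); rewrite rI => <-.
have connw x y : x \in I -> y \in I -> connect (eI I) x y.
  have sym : connect_sym (eI I).
    by apply: sym_connect_sym => a b /=; rewrite adjC andbCA andbA andbC andbA andbAC -andbA andbCA.
  by move=> xI yI; apply: connect_trans (connI y yI); rewrite sym connI.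
have pathI x y : x \in I -> y \in I -> exists p,
    [/\ path (@adj R L G) x p, {subset x :: p <= I}, uniq (x :: p) & y = last x p].
  move=> xI yI; have /connectP[p0 p0p ->] := connw x y xI yI.
  case: (shortenP p0p) => p pp pu _; exists p; split=> //.
    by apply: sub_path pp => a b /= /andP[].
  elim: p {p0 p0p pu} x xI pp => [|a p IHp] x xI /= => [_ b|/andP[/and3P[_ _ aI] pp] b].
    by rewrite inE => /eqP->.
  by rewrite inE => /predU1P[->//|]; exact: IHp.
(* A second neighbour of [u] in [I] would close a cycle through [u] and a path of [I] from [w]. *)
have nbrI x : x \in I -> adj u x -> x = w.
  move=> xI ux; have [p [pp pI pu xE]] := pathI w x wI xI.
  have [//|xw] := eqVneq x w; exfalso; apply: (acyc [:: u, w & p]).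
    by case: p xE xw {pp pI pu} => [->|//]; rewrite eqxx.
  apply/andP; split; last by rewrite cons_uniq pu andbT; apply: contra uI => /pI.
  by rewrite /cycle rcons_path /= (adjC u w) wu pp -xE (adjC x) ux.
(* A neighbour [x] of [u] outside [I] but in a star centred in [I] would close a cycle through [x],
   [u] and [w]. *)
have nbrNI x y : x \notin I -> adj u x -> y \in I -> adj y x -> False.
  move=> xI ux yI yx; have [p [pp pI pu yE]] := pathI w y wI yI.
  apply: (acyc [:: x, u, w & p]) => //; apply/andP; split; last first.
    rewrite !cons_uniq -cons_uniq pu andbT inE negb_or.
    apply/andP; split; last by apply: contra uI => /pI.
    rewrite (contra (@pI x) xI) andbT.
    by apply: contraTneq ux => ->; rewrite irr.
  by rewrite /cycle rcons_path /= (adjC x) ux (adjC u w) wu pp -yE.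
have [s [sw sinj spos]] : exists s : G -> H, [/\ s w = f w,
    {in neighbors u &, injective s} &
    forall u', adj u u' -> 0 < gamma ((u, f u), (u', s u'))].
  by apply: star_matching => //; rewrite (joiningC Jg) fpos.
(* Only the star of [u] is reassigned; its sole vertex with an earlier constraint is [w], and
   [s w = f w]. The vertex [u] keeps the value it received in the star of [w]. *)
pose f' x := if adj u x then s x else f x.
have f'I x : x \in I -> f' x = f x.
  by move=> xI; rewrite /f'; case: ifP => // /nbrI->.
have f'N x y : y \in I -> adj y x -> f' x = f x.
  move=> yI yx; have [xI|xI] := boolP (x \in I); first exact: f'I.
  by rewrite /f'; case: ifP => // ux; case: (nbrNI x y).
have f'u : f' u = f u by rewrite /f' irr.
exists (u |: I)%SET, f'; split; first by rewrite cardsU1 uI cI.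
have subI : subrel (connect (eI I)) (connect (eI (u |: I)%SET)).
  apply: connect_sub => x y /and3P[xy xI yI]; apply: connect1.
  by rewrite /= xy !inE xI yI !orbT.
split.
- by rewrite !inE rI orbT.
- move=> x; rewrite in_setU1 => /predU1P[->|xI]; last exact/subI/connI.
  apply: connect_trans (subI _ _ (connI w wI)) _.
  by apply: connect1; rewrite /= wu !inE wI eqxx !orbT.
- move=> x; rewrite in_setU1 => /predU1P[->|xI] y xy.
    by rewrite f'u /f' xy; exact: spos.
  by rewrite (f'I x)// (f'N y x)//; exact: fpos.
- move=> x; rewrite in_setU1 => /predU1P[->|xI] y z xy xz.
    by rewrite /f' /adj xy xz; exact: sinj.
  by rewrite (f'N y x)// (f'N z x)//; exact: finj xy xz.
Qed.

(** By injectivity on stars, a simple path of [G] is mapped to a walk of [H] that never turns back;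
    in the tree [H] such a walk does not close up, so [f] is injective. Equal degrees make [f] map
    stars onto stars, and connectedness of [H] then gives surjectivity. *)
Lemma support_map_isomorphism (f : G -> H) : trees G -> trees H ->
  (forall u u', adj u u' -> 0 < gamma ((u, f u), (u', f u'))) ->
  (forall u, {in neighbors u &, injective f}) ->
  [/\ bijective f, forall u u', weight G (u, u') = weight H (f u, f u') &
      forall u, label u = label (f u)].
Proof.
move=> tG tH fpos fstar.
have [[connG _ _] _] := tG; have [[connH acycH irrH] _] := tH.
have fadj x y : adj x y -> adj (f x) (f y).
  by move=> /fpos/(joining_weight_gt0_r Jg); rewrite adjE.
have fr u : 0 < marginal gamma (u, f u).
  by have [u' /fpos/(joining_marginal_gt0 Jg)] := tree_exists_neighbor u tG.
have finj : injective f.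
  move=> x y; have /connectP[p0 p0p ->] := connG x y.
  case: (shortenP p0p) => p pp pu _ fE.
  pose w i := f (nth x (x :: p) i).
  have winj : {in [pred i | i <= size p]%N &, injective w}.
    apply: (nonbacktracking_inj irrH acycH) => [i ip|i ip].
      by apply: fadj; exact: (pathP x pp).
    move=> /(fstar (nth x (x :: p) i.+1)).
    rewrite -!/(adj _ _) (adjC _ (nth x (x :: p) i)).
    rewrite (pathP x pp i.+1 ip) (pathP x pp i (ltnW ip)) => /(_ isT isT)/eqP.
    by rewrite nth_uniq //= ?gtn_eqF //; exact: leqW (ltnW ip).
  have := winj 0 (size p); rewrite !inE leqnn => /(_ isT isT).
  rewrite /w -last_nth => /(_ fE) p0E.
  by case: p {pp pu fE winj w} p0E.
have fnbr u : neighbors (f u) = (f @: neighbors u)%SET.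
  apply/esym/eqP; rewrite eqEcard; apply/andP; split.
    by apply/fintype.subsetP => _ /imsetP[u' uu' ->]; exact: fadj.
  rewrite card_in_imset; last exact: fstar.
  by have [_ /multiweight_degree->] := zero_cost_label (fr u).
have fbij : bijective f.
  apply: inj_card_bij => //.
  have [u _] : exists u : G, True by have [_ /card_gt1P[u _]] := tG; exists u.
  suff fT : codom f =i predT.
    rewrite (_ : #|H| = #|codom f|); first exact: leq_image_card.
    by apply: eq_card => y; rewrite fT.
  have step a b : a \in codom f -> adj a b -> b \in codom f.
    move=> /codomP[x ->] xb; have : b \in neighbors (f x) by [].
    by rewrite fnbr => /imsetP[z _ ->]; exact: codom_f.
  have clC : fingraph.closed (@adj R L H) (mem (codom f)).
    move=> a b ab; apply/idP/idP => [/step|/step]; first exact.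
    by apply; rewrite adjC.
  by move=> y; have := closed_connect clC (connH (f u) y); rewrite codom_f => <-.
have wE u u' : weight G (u, u') = weight H (f u, f u').
  have [uu'|uu'] := boolP (adj u u').
    by apply: support_weight; [by case: tG|exact: fpos].
  rewrite !weight_nadj// /adj fnbr; apply: contra uu' => /imsetP[z uz /finj->].
  exact: uz.
split=> // u; by have [] := zero_cost_label (fr u).
Qed.

End ZeroCost.
End Graphs.

Lemma sum_indicator (R : pzRingType) (T : finType) (c : R) (a : T) :
  \sum_x c * (x == a)%:R = c.
Proof.
rewrite (bigD1 a)//= eqxx mulr1 big1 ?addr0// => x /negbTE->.
by rewrite mulr0.
Qed.

(** * Affine combinations and rigidity of joinings *)

Section Affine.
Context {R : realType}.

Lemma marginal_affine (T : finType) (y z : T * T -> R) (a b : R) x :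
  marginal (fun i => a * y i + b * z i) x = a * marginal y x + b * marginal z x.
Proof. by rewrite /marginal big_split/= -!mulr_sumr. Qed.

Lemma total_cost_affine (L : Type) (K : eqType) (Psi : labeling) (G H : graph R L)
    (y z : (G * H) * (G * H) -> R) (a b : R) :
  total_cost (K := K) Psi (fun i => a * y i + b * z i) =
  a * total_cost Psi y + b * total_cost Psi z.
Proof.
rewrite /total_cost !mulr_sumr -big_split/=; apply: eq_bigr => x _.
by rewrite marginal_affine; ring.
Qed.

(** The coefficients may have any sign, and nonnegativity is asked of the combination: this serves
    to move from a joining away from another one. *)
Lemma weight_joining_affine (U V : finType) (alpha : U * U -> R)
    (beta : V * V -> R) y z (a b : R) :
  weight_joining alpha beta y -> weight_joining alpha beta z -> a + b = 1 ->
  (forall i, 0 <= a * y i + b * z i) ->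
  weight_joining alpha beta (fun i => a * y i + b * z i).
Proof.
move=> [[y0 yC y1] yp yq ya yb] [[z0 zC z1] zp zq za zb] ab g0.
split=> [|u|v|u u' v|u v v'].
- split=> [x x'|x x'|]; [exact: g0|by rewrite yC zC|].
  transitivity (\sum_x marginal (fun i => a * y i + b * z i) x); first by [].
  under eq_bigr do rewrite marginal_affine.
  by rewrite big_split/= -!mulr_sumr y1 z1 !mulr1.
- under eq_bigr do rewrite marginal_affine.
  by rewrite big_split/= -!mulr_sumr yp zp -mulrDl ab mul1r.
- under eq_bigr do rewrite marginal_affine.
  by rewrite big_split/= -!mulr_sumr yq zq -mulrDl ab mul1r.
- rewrite marginal_affine big_split/= -!mulr_sumr mulrDr mulrCA ya.
  by rewrite [X in _ + X]mulrCA za; ring.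
- rewrite marginal_affine big_split/= -!mulr_sumr mulrDr mulrCA yb.
  by rewrite [X in _ + X]mulrCA zb; ring.
Qed.

(** [t] is the minimum of one half and the finitely many ratios [a i / b i] with [b i] positive. *)
Lemma small_multiple_le (I : finType) (a b : I -> R) :
  (forall i, 0 <= a i) -> (forall i, 0 <= b i) ->
  (forall i, 0 < b i -> 0 < a i) ->
  exists2 t, 0 < t < 1 & forall i, t * b i <= a i.
Proof.
move=> a0 b0 ab.
suff [t t01 tab] : exists2 t, 0 < t < 1 & {in index_enum I, forall i, t * b i <= a i}.
  by exists t => // i; apply: tab; rewrite mem_index_enum.
elim: (index_enum I) => [|i s [t /andP[t0 t1] tab]].
  by exists 2^-1 => //; apply/andP; split; lra.
have [bi|] := ltP 0 (b i); last first.
  move=> bi; exists t; rewrite ?t0// => j; rewrite inE => /predU1P[->|/tab//].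
  by rewrite (le_anti (introT andP (conj bi (b0 i)))) mulr0.
exists (Num.min t (a i / b i)).
  by rewrite lt_min t0 divr_gt0 ?ab//= gt_min t1.
move=> j; rewrite inE => /predU1P[->|/tab]; first by rewrite -ler_pdivlMr// ge_min lexx orbT.
by apply: le_trans; rewrite ler_wpM2r// ge_min lexx.
Qed.

(** All the mass of [z] over [u] sits at its unique partner, so the transition condition sends
    exactly [alpha (u, u')] to the pair of partners. The right-hand side does not involve [z], so
    all such joinings coincide. *)
Lemma joining_of_bijective_support (U V : finType) (alpha : U * U -> R)
    (beta : V * V -> R) (gamma z : (U * V) * (U * V) -> R) :
  weight_joining alpha beta gamma -> bijective_joining gamma ->
  weight_joining alpha beta z ->
  (forall x, 0 < marginal z x -> 0 < marginal gamma x) ->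
  forall u v u' v', z ((u, v), (u', v')) =
    alpha (u, u') * (0 < marginal gamma (u, v))%R%:R
                  * (0 < marginal gamma (u', v'))%R%:R.
Proof.
move=> Jg [bu _] Jz sup u v u' v'.
have mz0 x : ~~ (0 < marginal gamma x) -> marginal z x = 0.
  move=> gx; have := joining_marginal_ge0 Jz x; rewrite le_eqVlt => /predU1P[//|/sup].
  by move=> gx'; rewrite gx' in gx.
have z0 x y : ~~ (0 < marginal gamma x) -> z (x, y) = 0.
  move=> /mz0 mx; have := joining_ge0 Jz x y.
  by rewrite le_eqVlt => /predU1P[//|/(joining_marginal_gt0 Jz)]; rewrite mx ltxx.
have other a b b' : 0 < marginal gamma (a, b) -> b' != b ->
    ~~ (0 < marginal gamma (a, b')).
  move=> gab b'b; apply/negP => gab'; have [c [_ cu]] := bu a.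
  by rewrite -(cu _ gab) -(cu _ gab') eqxx in b'b.
have [guv|/z0->] := boolP (0 < marginal gamma (u, v)); last by rewrite mulr0 mul0r.
have [guv'|guv'] := boolP (0 < marginal gamma (u', v')); last first.
  by rewrite (joiningC Jz) z0// !mulr0.
rewrite !mulr1.
have ruv : marginal z (u, v) = marginal alpha u.
  have [_ <- _ _ _] := Jz; rewrite (bigD1 v)//= big1 ?addr0// => b bv.
  exact/mz0/(other _ v).
have p0 := marginal_gt0_l Jg guv.
have := joining_transition_l Jz u' v p0.
rewrite ruv mulfV ?lt0r_neq0// mul1r => <-.
rewrite [RHS](bigD1 v')//= big1 ?addr0// => b bv.
by rewrite (joiningC Jz) z0//; exact: (other _ v').
Qed.

(** The image of the edge weight of [G] under the embedding of [G] as the graph of [f]. *)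
Definition map_joining (L : Type) (G H : graph R L) (f : G -> H) :
    (G * H) * (G * H) -> R :=
  fun z => weight G (z.1.1, z.2.1) * (z.1.2 == f z.1.1)%:R * (z.2.2 == f z.2.1)%:R.

End Affine.

(** * The joining carried by an isomorphism *)

Section MapJoining.
Context {R : realType} {L : eqType}.
Variables (G H : graph R L) (f : G -> H).
Hypothesis fbij : bijective f.
Hypothesis fweight : forall u u', weight G (u, u') = weight H (f u, f u').
Hypothesis flabel : forall u, label u = label (f u).

Lemma marginal_map_joining u v :
  marginal (map_joining f) (u, v) = marginal (weight G) u * (v == f u)%:R.
Proof.
rewrite /marginal -(pair_bigA _ (fun u' v' => map_joining f ((u, v), (u', v'))))/=.
rewrite mulr_suml; apply: eq_bigr => u' _.
by rewrite /map_joining/= sum_indicator.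
Qed.

Lemma marginal_iso u : marginal (weight H) (f u) = marginal (weight G) u.
Proof.
rewrite /marginal (reindex f)/=; last exact: onW_bij.
by apply: eq_bigr => u' _; rewrite fweight.
Qed.

Lemma map_joiningP : weight_joining (weight G) (weight H) (map_joining f).
Proof.
have [g fK gK] := fbij.
have eqE u v : (v == f u) = (u == g v).
  by apply/eqP/eqP => ->; rewrite ?fK ?gK.
split=> [|u|v|u u' v|u v v'].
- split=> [x y|x y|].
  + by rewrite /map_joining !mulr_ge0 ?weight_ge0.
  + by rewrite /map_joining weightC mulrAC.
  + rewrite -(pair_bigA _ (fun u v => \sum_y map_joining f ((u, v), y)))/=.
    have [_ _ <-] := weightP G; apply: eq_bigr => u _.
    by under eq_bigr do rewrite -/(marginal _ _) marginal_map_joining; rewrite sum_indicator.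
- by under eq_bigr do rewrite marginal_map_joining; rewrite sum_indicator.
- under eq_bigr do rewrite marginal_map_joining eqE.
  rewrite (bigD1 (g v))//= eqxx mulr1 big1 ?addr0 => [|u /negbTE->]; last by rewrite mulr0.
  by rewrite -marginal_iso gK.
- rewrite marginal_map_joining /map_joining/= sum_indicator; ring.
- rewrite marginal_map_joining /map_joining/=.
  under eq_bigr => w _ do rewrite [v' == _]eqE.
  rewrite (bigD1 (g v'))//= eqxx mulr1 big1 ?addr0 => [|w /negbTE->]; last by rewrite mulr0.
  have [->|] := eqVneq v (f u); last by rewrite !mulr0.
  by rewrite marginal_iso fweight gK; ring.
Qed.

Lemma multiweight_iso u : multiweight (f u) = multiweight u.
Proof.
apply/eq_seq_msetP.
have -> : [seq weight G (u, u') | u' in neighbors u] =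
    [seq weight H (f u, v') | v' <- [seq f u' | u' in neighbors u]].
  by rewrite -map_comp; apply: eq_map => u' /=; rewrite fweight.
apply/perm_map/uniq_perm; first exact: enum_uniq.
  by rewrite map_inj_uniq ?enum_uniq//; exact: bij_inj.
have [g fK gK] := fbij.
move=> v; rewrite mem_enum -[v]gK mem_map; last exact: bij_inj.
by rewrite mem_enum !inE fweight.
Qed.

Lemma total_cost_map_joining : total_cost (@augmented_label R L) (map_joining f) = 0.
Proof.
rewrite /total_cost big1// => -[u v] _; rewrite marginal_map_joining.
have [->|] := eqVneq v (f u); last by rewrite !mulr0.
by rewrite /label_cost /augmented_label/= flabel multiweight_iso eqxx mul0r.
Qed.

Lemma bijective_map_joining : trees G -> bijective_joining (map_joining f).
Proof.
move=> tG; have [g fK gK] := fbij.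
have mE u v : (0 < marginal (map_joining f) (u, v)) = (v == f u).
  rewrite marginal_map_joining; case: eqVneq => [|] _; last by rewrite mulr0 ltxx.
  rewrite mulr1; have [u' uu'] := tree_exists_neighbor u tG.
  rewrite /marginal (bigD1 u')//= ltr_wpDr ?sumr_ge0// -?adjE// => z _.
  exact: weight_ge0.
split=> [u|v].
  by exists (f u); split=> [|v]; rewrite mE ?eqxx// => /eqP.
exists (g v); split=> [|u]; rewrite mE ?gK ?eqxx// => /eqP->.
by rewrite fK.
Qed.

End MapJoining.

(** * Detection and identification of isomorphism *)

Section Main.
Context {R : realType} {L : eqType}.
Implicit Types G H : graph R L.

Lemma total_cost_ge0 (K : eqType) (Psi : labeling) G H gamma :
  weight_joining (weight G) (weight H) gamma ->
  0 <= total_cost (K := K) Psi gamma.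
Proof.
move=> Jg; apply: sumr_ge0 => x _.
by rewrite mulr_ge0 ?label_cost_ge0 ?(joining_marginal_ge0 Jg).
Qed.

Lemma isomorphic_ogj_cost0 G H : isomorphic G H ->
  ogj_cost (@augmented_label R L) G H = 0.
Proof.
move=> [f [fbij fw fl]].
have [g Jg [<- gmin]] := total_cost_attained (@augmented_label R L) G H.
apply/le_anti; rewrite (total_cost_ge0 _ Jg) andbT.
by rewrite -(total_cost_map_joining fbij fw fl); apply: gmin; exact: map_joiningP.
Qed.

(** The last clause is what allows a multiple of the joining of [f] to be split off from [gamma]. *)
Lemma zero_cost_isomorphism G H gamma : trees G -> trees H ->
  weight_joining (weight G) (weight H) gamma ->
  total_cost (@augmented_label R L) gamma = 0 ->
  exists f : G -> H,
    [/\ bijective f, forall u u', weight G (u, u') = weight H (f u, f u'),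
        forall u, label u = label (f u) &
        forall z, 0 < map_joining f z -> 0 < gamma z].
Proof.
move=> tG tH Jg c0; have [treeG _] := tG.
have [f [fpos fstar]] := exists_support_map Jg c0 treeG.
have [fbij fw fl] := support_map_isomorphism Jg c0 tG tH fpos fstar.
exists f; split=> // -[[u v] [u' v']]; rewrite /map_joining/=.
case: eqVneq => [->|_]; last by rewrite mulr0 mul0r ltxx.
case: eqVneq => [->|_]; last by rewrite mulr0 ltxx.
by rewrite !mulr1 -adjE; exact: fpos.
Qed.

Lemma detects_isomorphism_trees :
  detects_isomorphism (@augmented_label R L) (@trees R L).
Proof.
move=> G H tG tH; split; last exact: isomorphic_ogj_cost0.
(* The infimum is attained, so cost zero comes with an actual joining of cost zero. *)
have [g Jg [gE _]] := total_cost_attained (@augmented_label R L) G H.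
rewrite -gE => /(zero_cost_isomorphism tG tH Jg)[f [fbij fw fl _]].
by exists f.
Qed.

(** A small multiple of the joining of an isomorphism fits below [gamma]; the normalised remainder
    is again an optimal joining, so extremality forces [gamma] to be the joining of the
    isomorphism. *)
Lemma extreme_bijective G H gamma : trees G -> trees H ->
  ogj_cost (@augmented_label R L) G H = 0 ->
  extreme_points (@optimal_joining R L _ (@augmented_label R L) G H) gamma ->
  bijective_joining gamma.
Proof.
move=> tG tH cost0 [[Jg]]; rewrite cost0 => c0 ext.
have [f [fbij fw fl sup]] := zero_cost_isomorphism tG tH Jg c0.
have Jf := map_joiningP fbij fw; have cf := total_cost_map_joining fbij fw fl.
have [[x y]|[x y]|z /sup//|t /andP[t0 t1] tle] :=
  small_multiple_le (a := gamma) (b := map_joining f).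
- exact: joining_ge0 Jg _ _.
- exact: joining_ge0 Jf _ _.
have s0 : 1 - t != 0 by rewrite subr_eq0 gt_eqF.
(* These coefficients solve [gamma = t * map_joining f + (1 - t) * z] for [z], and they sum to
   one. *)
pose a := (1 - t)^-1; pose b := - (t / (1 - t)).
pose z i := a * gamma i + b * map_joining f i.
have Jz : weight_joining (weight G) (weight H) z.
  apply: weight_joining_affine => //; first by rewrite /a /b; field.
  move=> i; rewrite /a /b.
  have -> : (1 - t)^-1 * gamma i + - (t / (1 - t)) * map_joining f i =
    (gamma i - t * map_joining f i) / (1 - t) by field.
  by rewrite divr_ge0 ?subr_ge0// ltW.
have cz : total_cost (@augmented_label R L) z = 0.
  by rewrite total_cost_affine c0 cf !mulr0 addr0.
have [| | | |fg _] := ext (map_joining f) z t.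
- by split=> //; rewrite cost0.
- by split=> //; rewrite cost0.
- by rewrite t0.
- apply/funext => i.
  change (gamma i = t * map_joining f i + (1 - t) * z i).
  by rewrite /z /a /b; field.
by rewrite -fg; exact: bijective_map_joining.
Qed.

(** In a proper convex decomposition of [gamma] the marginals of both parts are supported where that
    of [gamma] is, and a bijective support determines the joining. *)
Lemma bijective_extreme G H gamma :
  ogj_cost (@augmented_label R L) G H = 0 ->
  weight_joining (weight G) (weight H) gamma ->
  bijective_joining gamma ->
  total_cost (@augmented_label R L) gamma = 0 ->
  extreme_points (@optimal_joining R L _ (@augmented_label R L) G H) gamma.
Proof.
move=> cost0 Jg bg c0; split; first by split=> //; rewrite cost0.
have determined z : weight_joining (weight G) (weight H) z ->
    (forall x, 0 < marginal z x -> 0 < marginal gamma x) -> z = gamma.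
  move=> Jz sup; apply/funext => -[[u v] [u' v']].
  rewrite (joining_of_bijective_support Jg bg Jz sup).
  by rewrite (joining_of_bijective_support Jg bg Jg).
move=> y z t [Jy _] [Jz _] /andP[t0 t1] gE.
have mE x : marginal gamma x = t * marginal y x + (1 - t) * marginal z x.
  by rewrite -marginal_affine gE.
have s0 : 0 < 1 - t by rewrite subr_gt0.
split; apply: determined => // x mx; rewrite mE.
  by rewrite ltr_wpDr ?mulr_gt0// mulr_ge0 ?(joining_marginal_ge0 Jz)// ltW.
by rewrite ltr_wpDl ?mulr_gt0// mulr_ge0 ?(joining_marginal_ge0 Jy)// ltW.
Qed.

End Main.

Theorem theorem4p8 (R : realType) (L : eqType) :
  detects_isomorphism (@augmented_label R L) (@trees R L) /\
  identifies_isomorphism (@augmented_label R L) (@trees R L).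
Proof.
split; first exact: detects_isomorphism_trees.
move=> G H tG tH /isomorphic_ogj_cost0 cost0; apply/seteqP; split=> gamma.
  move=> eg; have [[Jg]] := eg; rewrite cost0 => c0 _.
  by split=> //; exact: extreme_bijective eg.
by move=> [Jg bg c0]; exact: bijective_extreme.
Qed.
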